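(* Let $k_1,\ldots,k_n$ be natural numbers (positive integers) whose sum is $m$, $m\ge2$. Then for any real Banach space $X$ $$\mathbb{R}(k_1,\ldots,k_n;X)\le\frac{n^{m-1}}{m!}\big(k_1^{m-1}+\cdots+k_n^{m-1}\big).$$
   Context: Let $X$ be a real Banach space with closed unit ball $B_X$. $\mathcal{L}^s({}^mX;\mathbb{R})$ denotes the space of continuous symmetric $m$-linear forms $L:X^m\to\mathbb{R}$. For such $L$, $\widehat{L}(x)=L(x,\ldots,x)$ and $\|\widehat{L}\|=\sup_{x\in B_X}|\widehat{L}(x)|$. For $k_1+\cdots+k_n=m$, $L(x_1^{k_1}\ldots x_n^{k_n})$ denotes the value of $L$ with $x_i$ placed in $k_i$ of the coordinates. Define $$\mathbb{R}(k_1,\ldots,k_n;X)=\inf\Big\{M>0:\ \sup_{x_1,\ldots,x_n\in B_X}|L(x_1^{k_1}\ldots x_n^{k_n})|\le M\|\widehat{L}\|\ \ \forall L\in\mathcal{L}^s({}^mX;\mathbb{R})\Big\}.$$ *)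

(* Defs.v *)
From HB Require Import structures.
From mathcomp Require Import all_boot all_order all_fingroup all_algebra.
From mathcomp Require Import all_classical all_reals all_analysis.

Set Implicit Arguments.
Unset Strict Implicit.
Unset Printing Implicit Defensive.

Import Order.TTheory GRing.Theory Num.Theory.
Import numFieldNormedType.Exports.

Local Open Scope classical_set_scope.
Local Open Scope ring_scope.

Section PolarizationConstant.
Context {R : realType} {X : normedModType R}.

Definition unit_ball : set X := [set x | `|x| <= 1].

Definition multilinear (m : nat) (L : ('I_m -> X) -> R) : Prop :=
  forall (x : 'I_m -> X) (i : 'I_m), scalar (fun u => L [eta x with i |-> u]).

Definition symmetric_form (m : nat) (L : ('I_m -> X) -> R) : Prop :=
  forall (s : 'S_m) (x : 'I_m -> X), L (x \o s) = L x.

(* Joint continuity: {ptws 'I_m -> X} is X^m with the product topology. *)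
Definition sym_multilinear_forms (m : nat) : set (('I_m -> X) -> R) :=
  [set L | [/\ multilinear L, symmetric_form L
             & continuous (L : {ptws 'I_m -> X} -> R)]].

Definition hat (m : nat) (L : ('I_m -> X) -> R) (x : X) : R := L (fun=> x).

(* Suprema and infima are taken in \bar R, so that no junk value can arise
   from an unbounded or empty set of reals. *)
Definition polynomial_norm (m : nat) (L : ('I_m -> X) -> R) : \bar R :=
  ereal_sup [set `|hat L x|%:E | x in unit_ball].

(* The argument x_1^{k_1} ... x_n^{k_n}: k_1 copies of x_1, followed by k_2
   copies of x_2, and so on; the list has length \sum_i k i, so the default
   value of nth is never used. *)
Definition repeat_args (n : nat) (k : 'I_n -> nat) (x : 'I_n -> X) :
    'I_(\sum_(i < n) k i) -> X :=
  fun j => nth 0 (flatten [seq nseq (k i) (x i) | i <- enum 'I_n]) j.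

End PolarizationConstant.

Arguments sym_multilinear_forms {R} X m.
Arguments repeat_args {R X n} k x _.

Definition polarization_constant (R : realType) (n : nat) (k : 'I_n -> nat)
    (X : normedModType R) : \bar R :=
  ereal_inf [set M%:E | M in [set M : R | 0 < M /\
    forall L, sym_multilinear_forms X (\sum_(i < n) k i)%N L ->
      (ereal_sup [set `|L (repeat_args k x)|%:E
                   | x in [set x : 'I_n -> X | forall i, unit_ball (x i)]]
       <= M%:E * polynomial_norm L)%E]].

(* Main.v *)
Require Import Defs.
From HB Require Import structures.
From mathcomp Require Import all_boot all_order all_fingroup all_algebra.
From mathcomp Require Import all_classical all_reals all_analysis.
From mathcomp Require Import ring lra.

Import Order.TTheory GRing.Theory Num.Theory.
Import numFieldNormedType.Exports.

Local Open Scope ring_scope.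

(** The proof averages over random signs [e j], [j < m]. Let [C] be the norm
    of the polynomial [hat L], and write [L (x_1^{k_1} ... x_n^{k_n})] as
    [L (x \o b)], where [b] sends each of the [m] coordinates to the index of
    its vector.

    The polarization formula ([polarization]) reads
      [2 ^ m * m! * L y =
         \sum_e (\prod_j e j) * hat L (\sum_j e j *: y j)].
    It holds because expanding [hat L] by multilinearity ([hat_sum]) gives one
    term for each map [f] from the coordinates to themselves, and averaging
    over the signs kills all maps that are not permutations ([sum_sign_map]);
    by symmetry each of the [m!] remaining terms is [L y].

    For [y = x \o b] the vector inside [hat L] is [\sum_i S_i *: x i], where
    [S_i] is the sum of the [k_i] signs of the [i]-th block. Its norm is at
    most [\sum_i |S_i|], so the polynomial takes there a value of size at most
      [C * (\sum_i |S_i|) ^ m <= C * n ^ (m - 1) * \sum_i |S_i| ^ m]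
    by the power mean inequality ([power_mean]). Since [|S_i| <= k_i] and
    [m >= 2], the [m]-th moment of [S_i] is at most [k_i ^ (m - 2)] times its
    second moment, which is [k_i] by orthogonality of the signs
    ([sum_sign_sqr]). Hence the mean of [|S_i| ^ m] is at most
    [k_i ^ (m - 1)], and dividing by [m!] gives the bound
    ([polarization_le]). *)

(** * Random signs *)

Definition sign {R : comNzRingType} {T : finType} (e : {ffun T -> bool}) (j : T) : R :=
  (-1) ^+ e j.

(** The signs are independent, so the sum of the products is the product over
    [j] of the sums over the two values of the [j]-th sign. A factor is 2 when
    the exponent [c j] is even and 0 when it is odd. *)
Lemma sum_prod_sign (R : comNzRingType) (T : finType) (c : T -> nat) :
  \sum_(e : {ffun T -> bool}) \prod_j (sign e j : R) ^+ c j =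
  \prod_j (1 + (-1) ^+ c j).
Proof.
rewrite -(bigA_distr_bigA (fun j (b : bool) => ((-1) ^+ b : R) ^+ c j)) /=.
by apply: eq_bigr => j _; rewrite big_bool expr1 expr0 expr1n addrC.
Qed.

Lemma sum_prod_sign_even (R : comNzRingType) (T : finType) (c : T -> nat) :
  (forall j, ~~ odd (c j)) ->
  \sum_(e : {ffun T -> bool}) \prod_j (sign e j : R) ^+ c j = 2 ^+ #|T|.
Proof.
move=> c_even; rewrite sum_prod_sign -prodr_const; apply: eq_bigr => j _.
by rewrite -signr_odd (negPf (c_even j)).
Qed.

Lemma sum_prod_sign_odd (R : comNzRingType) (T : finType) (c : T -> nat) (j : T) :
  odd (c j) ->
  \sum_(e : {ffun T -> bool}) \prod_j (sign e j : R) ^+ c j = 0.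
Proof.
move=> cj_odd; rewrite sum_prod_sign (bigD1 j) //= -signr_odd cj_odd.
by rewrite expr1 subrr mul0r.
Qed.

(** The sign [e j] occurs here with exponent one plus the size of the fibre of
    [f] over [j]. All these exponents are even when [f] is a permutation;
    otherwise a point [j] outside the image of [f] has exponent 1, which makes
    the sum vanish. *)
Lemma sum_sign_map (R : comNzRingType) (T : finType) (f : {ffun T -> T}) :
  \sum_(e : {ffun T -> bool}) (\prod_j sign e j) * (\prod_i sign e (f i)) =
  if injectiveb f then 2 ^+ #|T| else 0 :> R.
Proof.
pose c j := (#|[pred i | f i == j]|).+1.
have -> : \sum_(e : {ffun T -> bool})
            (\prod_j sign e j) * (\prod_i sign e (f i)) =
          \sum_(e : {ffun T -> bool}) \prod_j (sign e j : R) ^+ c j.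
  apply: eq_bigr => e _.
  rewrite [X in _ * X](partition_big f xpredT) //= -big_split /=.
  apply: eq_bigr => j _; rewrite exprS -prodr_const; congr (_ * _).
  by apply: eq_bigr => i /eqP ->.
case: ifPn => [/injectiveP f_inj|f_ninj].
  apply: sum_prod_sign_even => j.
  have [g fK gK] := injF_bij f_inj.
  rewrite /c (_ : #|_| = 1%N) // -(card1 (g j)); apply: eq_card => i.
  by rewrite !inE -{1}(gK j) (inj_eq f_inj).
have [j jf] : exists j, j \notin codom f.
  apply/existsP; apply: contraR f_ninj; rewrite negb_exists => /forallP f_surj.
  have /image_injP f_inj : #|codom f| == #|T|.
    by apply/eqP/eq_card => j; rewrite (negbNE (f_surj j)).
  by apply/injectiveP => x y; apply: f_inj.
apply: (sum_prod_sign_odd R T c j); rewrite /c eq_card0 // => i; rewrite !inE.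
by apply: contraNF jf => /eqP <-; apply: codom_f.
Qed.

(** Distinct signs are orthogonal, so only the diagonal terms of the squared
    sum survive. *)
Lemma sum_sign_sqr (R : comNzRingType) (T : finType) (A : pred T) :
  \sum_(e : {ffun T -> bool}) (\sum_(j | A j) sign e j) ^+ 2 =
  2 ^+ #|T| * #|A|%:R :> R.
Proof.
under eq_bigr => e _ do rewrite expr2 big_distrlr /=.
rewrite exchange_big /= -sumr_const mulr_sumr; apply: eq_bigr => j Aj.
rewrite exchange_big (bigD1 j) //= [X in _ + X]big1 => [|l /andP[_ ljN]].
  rewrite addr0 mulr1 (eq_bigr (fun=> 1)) => [|e _]; last first.
    by rewrite -expr2 sqrr_sign.
  by rewrite sumr_const card_ffun card_bool natrX.
pose c t := ((t == j) + (t == l))%N.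
have cj : odd (c j) by rewrite /c eqxx eq_sym (negPf ljN).
rewrite -[RHS](sum_prod_sign_odd R T c j cj); apply: eq_bigr => e _.
under [RHS]eq_bigr => t _ do rewrite exprD.
rewrite big_split /=; congr (_ * _).
  by rewrite (bigD1 j) //= eqxx big1 ?mulr1 // => t /negPf ->.
by rewrite (bigD1 l) //= eqxx big1 ?mulr1 // => t /negPf ->.
Qed.

(** * The power mean inequality *)

(** This is Chebyshev's sum inequality: [a i] and [a i ^+ p] are ordered alike,
    so [(a i - a j) * (a i ^+ p - a j ^+ p)] is nonnegative for all [i] and
    [j]; summing over all pairs gives twice the difference of the two sides. *)
Lemma chebyshev_sum_exp (R : realDomainType) (I : finType) (a : I -> R) p :
  (forall i, 0 <= a i) ->
  (\sum_i a i) * (\sum_i a i ^+ p) <= #|I|%:R * \sum_i a i ^+ p.+1.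
Proof.
move=> a_ge0.
have : 0 <= \sum_i \sum_j (a i - a j) * (a i ^+ p - a j ^+ p).
  apply: sumr_ge0 => i _; apply: sumr_ge0 => j _.
  case: (leP (a i) (a j)) => [aij|/ltW aij].
    by rewrite mulr_le0 // subr_le0 // lerXn2r ?nnegrE.
  by rewrite mulr_ge0 // subr_ge0 // lerXn2r ?nnegrE.
rewrite (eq_bigr (fun i => (#|I|%:R * a i ^+ p.+1 + \sum_j a j ^+ p.+1) -
    (a i * (\sum_j a j ^+ p) + (\sum_j a j) * a i ^+ p))) => [|i _]; last first.
  rewrite (mulr_suml _ _ _ (a i ^+ p)) mulr_sumr mulr_natl -sumr_const.
  rewrite -!big_split /= -sumrB; apply: eq_bigr => j _; rewrite !exprS; ring.
rewrite sumrB !big_split /= -mulr_sumr -mulr_suml -mulr_sumr sumr_const.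
rewrite -[X in _ + X - _]mulr_natl; lra.
Qed.

Lemma power_mean (R : realDomainType) (I : finType) (a : I -> R) p :
  (forall i, 0 <= a i) ->
  (\sum_i a i) ^+ p.+1 <= #|I|%:R ^+ p * \sum_i a i ^+ p.+1.
Proof.
move=> a_ge0; elim: p => [|p IHp]; first by rewrite expr0 mul1r expr1.
rewrite exprS; apply: le_trans (ler_wpM2l _ IHp) _; first exact: sumr_ge0.
rewrite mulrCA exprSr -mulrA ler_wpM2l ?exprn_ge0 //.
exact: chebyshev_sum_exp.
Qed.

(** * Multilinear forms and polarization *)

Lemma scalar_sumZ (R : nzRingType) (X : lmodType R) (g : X -> R) :
  scalar g -> forall (J : finType) (a : J -> R) (y : J -> X),
  g (\sum_j a j *: y j) = \sum_j a j * g (y j).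
Proof.
move=> g_lin J a y; have g0 : g 0 = 0.
  have := g_lin 1 0 0; rewrite scaler0 addr0 mul1r => g00.
  by apply: (addrI (g 0)); rewrite -g00 addr0.
apply: (big_ind2 (fun u r => g u = r)) => [//|u r v s <- <-|j _].
  by have := g_lin 1 u v; rewrite scale1r mul1r.
by have := g_lin (a j) (y j) 0; rewrite !addr0 g0 addr0.
Qed.

Section Form.
Context {R : realType} {X : normedModType R} {m : nat} {L : ('I_m -> X) -> R}.
Hypothesis L_multi : multilinear L.

(** Coordinates are expanded one at a time. For a set [A] of coordinates, [G A]
    is the term attached to [f] when the coordinates in [A] still carry the
    unexpanded sum [z], and hence do not depend on [f]. The sum over all [f]
    then counts each partially expanded term [#|J| ^ #|A|] times. Comparing [A]
    full with [A] empty gives the expansion multiplied by [#|J| ^ m], a factor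
    that can be cancelled as [J] is nonempty. *)
Lemma hat_sum (J : finType) (a : J -> R) (y : J -> X) : (0 < #|J|)%N ->
  hat L (\sum_j a j *: y j) =
  \sum_(f : {ffun 'I_m -> J}) (\prod_i a (f i)) * L (y \o f).
Proof.
move=> J_gt0; set z := \sum_j _.
pose G (A : {set 'I_m}) (f : {ffun 'I_m -> J}) :=
  (\prod_(i | i \notin A) a (f i)) *
  L (fun i => if i \in A then z else y (f i)).
have step (A : {set 'I_m}) i : i \notin A ->
    \sum_f G (i |: A) f = #|J|%:R * \sum_f G A f.
  move=> iA.
  pose upd (f : {ffun 'I_m -> J}) j := [ffun l => if l == i then j else f l].
  have GE f : G (i |: A) f = \sum_j G A (upd f j).
    pose w l := if l \in A then z else y (f l).
    have -> : G (i |: A) f = (\prod_(l | l \notin i |: A) a (f l)) *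
                             L [eta w with i |-> z].
      congr (_ * L _); apply/funext => l; rewrite /w /= in_setU1.
      by case: eqP.
    rewrite (scalar_sumZ _ _ _ (L_multi w i)) mulr_sumr; apply: eq_bigr => j _.
    rewrite mulrA [_ * a j]mulrC; congr (_ * L _).
      rewrite [RHS](bigD1 i) //= /upd ffunE eqxx; congr (_ * _).
      apply: eq_big => l; first by rewrite in_setU1 negb_or andbC.
      by rewrite in_setU1 negb_or /upd ffunE => /andP[/negPf ->].
    apply/funext => l; rewrite /w /= /upd ffunE.
    by case: eqP => // ->; rewrite (negPf iA).
  under eq_bigr => f _ do rewrite GE.
  rewrite pair_big /=.
  (* Exchanging [j] with the value of [f] at [i] permutes the pairs [(f, j)]
     and turns [upd f j] into [f], so the sum over [j] becomes constant. *)
  pose swap (p : {ffun 'I_m -> J} * J) := (upd p.1 p.2, p.1 i).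
  have swapK : involutive swap.
    case=> f j; rewrite /swap /upd /=; congr (_, _); last by rewrite ffunE eqxx.
    by apply/ffunP => l; rewrite !ffunE /=; case: eqP => // ->.
  rewrite (reindex_inj (inv_inj swapK)) /=.
  rewrite (eq_bigr (fun p => G A p.1)) => [|p _]; last first.
    by have := swapK p; case: p => f j [] ->.
  rewrite -(pair_big xpredT xpredT (fun f (_ : J) => G A f)) /=.
  under eq_bigr => f _ do rewrite sumr_const -mulr_natl.
  by rewrite -mulr_sumr.
have sumG q (A : {set 'I_m}) : #|A| = q ->
    \sum_f G A f = #|J|%:R ^+ q * \sum_f G finset.set0 f.
  elim: q A => [|q IHq] A cardA; first by rewrite (cards0_eq cardA) mul1r.
  have /card_gt0P[i iA] : (0 < #|A|)%N by rewrite cardA.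
  rewrite -(finset.setD1K iA) step ?setD11 // IHq ?exprS ?mulrA //.
  by move: cardA; rewrite (cardsD1 i) iA => -[].
have J_neq0 : #|J|%:R ^+ m != 0 :> R by rewrite expf_neq0 // pnatr_eq0 -lt0n.
apply: (mulfI J_neq0).
transitivity (\sum_f G finset.setT f).
  rewrite (eq_bigr (fun=> hat L z)) => [|f _].
    by rewrite sumr_const card_ffun card_ord -natrX mulr_natl.
  rewrite /G big_pred0 => [|i]; last by rewrite finset.in_setT.
  by rewrite mul1r; congr L; apply/funext => i; rewrite finset.in_setT.
rewrite (sumG m) ?cardsT ?card_ord //; congr (_ * _); apply: eq_bigr => f _.
rewrite /G; congr (_ * L _); last by apply/funext => i; rewrite finset.in_set0.
by apply: eq_bigl => i; rewrite finset.in_set0.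
Qed.

Lemma hatZ (r : R) (u : X) : hat L (r *: u) = r ^+ m * hat L u.
Proof.
(* [r *: u] is a linear combination indexed by a one-point type, and there is
   a single map into that type. *)
have := @hat_sum unit (fun=> r) (fun=> u) _; rewrite card_unit => /(_ isT).
rewrite big_const card_unit /= addr0 => ->.
rewrite (eq_bigr (fun=> r ^+ m * hat L u)) => [|f _].
  by rewrite sumr_const card_ffun card_unit exp1n.
by rewrite prodr_const card_ord.
Qed.

Lemma hat_le (C : R) : (forall u, unit_ball u -> `|hat L u| <= C) ->
  forall z, `|hat L z| <= C * `|z| ^+ m.
Proof.
move=> L_le z; pose u := `|z|^-1 *: z.
(* This also holds for [z = 0], where the inverse of the norm is 0. *)
have zE : z = `|z| *: u.
  have [->|z_neq0] := eqVneq z 0; first by rewrite normr0 scale0r.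
  by rewrite /u scalerA divff ?normr_eq0 // scale1r.
rewrite {1}zE hatZ normrM normrX normr_id mulrC ler_wpM2r ?exprn_ge0 //.
apply: L_le; rewrite /unit_ball /= normrZ normfV normr_id.
have [->|z_neq0] := eqVneq z 0; first by rewrite normr0 mulr0.
by rewrite mulVf ?normr_eq0.
Qed.

Hypothesis L_sym : Defs.symmetric_form L.

(** After expansion, the average over the signs selects the maps [f] that are
    injective, hence permutations of the coordinates; for these, symmetry gives
    [L (y \o f) = L y]. *)
Lemma polarization (y : 'I_m -> X) : (0 < m)%N ->
  \sum_(e : {ffun 'I_m -> bool}) (\prod_j sign e j) * hat L (\sum_j sign e j *: y j)
  = 2 ^+ m * m`!%:R * L y.
Proof.
move=> m_gt0.
rewrite (eq_bigr (fun e => \sum_(f : {ffun 'I_m -> 'I_m})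
  (\prod_j sign e j) * (\prod_i sign e (f i)) * L (y \o f))) => [|e _]; last first.
  rewrite hat_sum ?card_ord // mulr_sumr.
  by apply: eq_bigr => f _; rewrite mulrA.
rewrite exchange_big /=.
under eq_bigr => f _ do rewrite -mulr_suml sum_sign_map card_ord.
rewrite (bigID (fun f : {ffun 'I_m -> 'I_m} => injectiveb f)) /=.
rewrite [X in _ + X]big1 => [|f /negPf ->]; last by rewrite mul0r.
rewrite addr0 (eq_bigr (fun=> 2 ^+ m * L y)) => [|f f_inj].
  rewrite sumr_const -[LHS]mulr_natl mulrCA mulrA; congr (_ * _%:R * _).
  have := card_inj_ffuns 'I_m 'I_m; rewrite card_ord ffactnn => <-.
  by apply: eq_card => f; rewrite inE.
rewrite f_inj; congr (_ * _).
rewrite -(L_sym (perm (injectiveP _ f_inj)) y); congr L; apply/funext => j /=.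
by rewrite permE.
Qed.

(** The polarization formula is applied to [y = x \o b]. The vectors in one
    fibre of [b] coincide, so their signs add up to a random walk [S e i]. Of the
    [m] factors of [|S e i| ^ m], only [m - 2] are bounded by the size of the
    fibre; the other two are kept for the exact second moment, which saves one
    power of that size. *)
Lemma polarization_le (I : finType) (b : 'I_m -> I) (x : I -> X) (C : R) :
  (2 <= m)%N -> (forall i, unit_ball (x i)) ->
  (forall u, unit_ball u -> `|hat L u| <= C) ->
  `|L (x \o b)| <= #|I|%:R ^+ (m - 1) / m`!%:R *
    (\sum_i #|[pred j | b j == i]|%:R ^+ (m - 1)) * C.
Proof.
move=> m_ge2 x_le L_le.
have C_ge0 : 0 <= C.
  by apply: le_trans (L_le 0 _); rewrite ?normr_ge0 // /unit_ball /= normr0.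
pose S (e : {ffun 'I_m -> bool}) i : R := \sum_(j | b j == i) sign e j.
have S_le e i : `|S e i| <= #|[pred j | b j == i]|%:R.
  apply: le_trans (ler_norm_sum _ _ _) _.
  rewrite (eq_bigr (fun=> 1)) ?sumr_const // => j _.
  by rewrite /sign normr_sign.
have norm_le e : `|\sum_j sign e j *: x (b j)| <= \sum_i `|S e i|.
  rewrite (partition_big b xpredT) //=.
  apply: le_trans (ler_norm_sum _ _ _) _; apply: ler_sum => i _.
  rewrite (eq_bigr (fun j => sign e j *: x i)) => [|j /eqP -> //].
  by rewrite -scaler_suml normrZ ler_piMr // x_le.
have moment i :
    \sum_e `|S e i| ^+ m <= 2 ^+ m * #|[pred j | b j == i]|%:R ^+ (m - 1).
  have mE : m = (2 + (m - 2))%N by rewrite subnKC.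
  have -> : (m - 1 = (m - 2).+1)%N by rewrite -subSn.
  have := sum_sign_sqr R _ (fun j => b j == i); rewrite card_ord exprS mulrA => <-.
  rewrite mulr_suml; apply: ler_sum => e _.
  rewrite {1}mE exprD -normrX ger0_norm ?sqr_ge0 // ler_wpM2l ?sqr_ge0 //.
  by rewrite lerXn2r ?nnegrE // S_le.
have pos : 0 < 2 ^+ m * m`!%:R :> R.
  by rewrite mulr_gt0 ?exprn_gt0 // ltr0n fact_gt0.
rewrite -(ler_pM2l pos) -[X in X * `|_|](gtr0_norm pos) -normrM.
rewrite -polarization ?(ltnW m_ge2) //.
apply: le_trans (ler_norm_sum _ _ _) _.
apply: (@le_trans _ _ (\sum_e C * (#|I|%:R ^+ (m - 1) * \sum_i `|S e i| ^+ m))).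
  apply: ler_sum => e _; rewrite normrM normr_prod big1 => [|j _]; last first.
    by rewrite normr_sign.
  rewrite mul1r; apply: le_trans (hat_le _ L_le _) _; rewrite ler_wpM2l //.
  apply: (@le_trans _ _ ((\sum_i `|S e i|) ^+ m)).
    by rewrite lerXn2r ?nnegrE ?sumr_ge0.
  have {1 3}-> : m = (m - 1).+1 by rewrite subn1 prednK // ltnW.
  exact: power_mean.
rewrite -mulr_sumr -mulr_sumr exchange_big /=.
set K := \sum_i _ ^+ (m - 1).
have -> : 2 ^+ m * m`!%:R * (#|I|%:R ^+ (m - 1) / m`!%:R * K * C) =
          C * (#|I|%:R ^+ (m - 1) * (2 ^+ m * K)).
  by field; rewrite pnatr_eq0 -lt0n fact_gt0.
rewrite !ler_wpM2l ?exprn_ge0 // mulr_sumr; exact: ler_sum.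
Qed.
End Form.

(** * The block structure of the arguments *)

(** The map [b] reads off the list of indices in which each [i] is repeated
    [k i] times, the same list from which [repeat_args] is built with [x i] in
    place of [i]. *)
Lemma repeat_args_comp (R : realType) (X : normedModType R) (n : nat)
    (k : 'I_n -> nat) :
  (0 < \sum_(i < n) k i)%N ->
  exists b : 'I_(\sum_(i < n) k i) -> 'I_n,
    (forall x : 'I_n -> X, repeat_args k x = x \o b) /\
    (forall i, #|[pred j | b j == i]| = k i).
Proof.
move=> k_gt0.
pose s := flatten [seq nseq (k i) i | i <- enum 'I_n].
have size_s : size s = (\sum_(i < n) k i)%N.
  rewrite size_flatten /shape -map_comp sumnE big_map big_enum /=.
  by apply: eq_bigr => i _; rewrite size_nseq.
(* [i0] is only a default for [nth]; all positions used are inside [s]. *)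
have [i0 _] : exists i0 : 'I_n, i0 \in s.
  by case: s size_s k_gt0 => [<- //|i s' _ _]; exists i; rewrite mem_head.
exists (fun j => nth i0 s j); split=> [x|i].
  apply/funext => j; rewrite /repeat_args /= -(nth_map i0 0 x) ?size_s //.
  rewrite map_flatten -map_comp; congr (nth _ (flatten _) _).
  by apply: eq_map => i /=; rewrite map_nseq.
have -> : k i = count_mem i s.
  rewrite count_flatten -map_comp sumnE big_map big_enum /= (bigD1 i) //=.
  rewrite count_nseq /= eqxx mul1n big1 ?addn0 // => l /negPf li.
  by rewrite count_nseq /= li.
rewrite -[in RHS](mkseq_nth i0 s) size_s /mkseq count_map -val_enum_ord count_map.
by rewrite enumT cardE size_filter.
Qed.

Theorem proposition13 (R : realType) (n m : nat) (k : 'I_n -> nat)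
    (hk : forall i, (0 < k i)%N)
    (hkm : (\sum_(i < n) k i)%N = m)
    (hm : (2 <= m)%N)
    (X : completeNormedModType R) :
  (polarization_constant k X <=
     (n%:R ^+ (m - 1) / (m`!)%:R * \sum_(i < n) (k i)%:R ^+ (m - 1))%:E)%E.
Proof.
subst m; set m := (\sum_(i < n) k i)%N.
have [b [bE b_card]] := @repeat_args_comp R X n k (ltnW hm).
have i0 : 'I_n := b (Ordinal (ltnW hm)).
set M := _ * _.
have M_gt0 : 0 < M.
  rewrite !mulr_gt0 ?invr_gt0 ?exprn_gt0 ?ltr0n ?fact_gt0 //.
    exact: leq_ltn_trans (ltn_ord i0).
  rewrite (bigD1 i0) //= ltr_wpDr ?exprn_gt0 ?ltr0n //.
  by apply: sumr_ge0 => i _; rewrite exprn_ge0.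
apply: ereal_inf_lbound; exists M => //; split=> // L [L_multi L_sym _].
apply: ub_ereal_sup => _ [x x_le <-].
have norm_ub u : unit_ball u -> (`|hat L u|%:E <= polynomial_norm L)%E.
  by move=> u_le; apply: ereal_sup_ubound; exists u.
have norm_ge0 : (0 <= polynomial_norm L)%E.
  by apply: le_trans (norm_ub 0 _); rewrite ?lee_fin // /unit_ball /= normr0.
(* If the polynomial norm is infinite, so is its product with [M > 0]. *)
case: (polynomial_norm L) norm_ub norm_ge0 => [C norm_ub _|_ _|_ //]; last first.
  by rewrite gt0_muley ?lte_fin // leey.
rewrite -EFinM lee_fin bE.
have := @polarization_le R X _ L L_multi L_sym _ b x C hm x_le norm_ub.
rewrite card_ord (eq_bigr (fun i => (k i)%:R ^+ (m - 1) : R)) // => i _.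
by rewrite b_card.
Qed.
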